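(* Let $N\ge1$ and let $I$ be any initial condition for the multiparticle model $(T,I,N)$. The following are equivalent: (i) The trajectory of each particle in the $(T,I,N)$ model is bounded for $t\ge0$. (ii) The trajectory of each particle in the $(T,I,N)$ model is bounded for all time $t\in(-\infty,\infty)$. (iii) The $(T,I,N)$ model is periodic for $t\ge0$. (iv) The $(T,I,N)$ model is periodic for all time $t\in(-\infty,\infty)$.
   Context: **Lattice.** $T=(\mathbb{T},\mathbb{B})$ is the triangular lattice with sites $\mathbb{T}=\{a(1,0)+b(1/2,\sqrt3/2):a,b\in\mathbb{Z}\}\subset\mathbb{R}^2$; its bonds $\mathbb{B}$ are the unit segments joining sites at distance $1$ (each site has six neighbors). **Multiparticle model $(T,I,N)$, unit speed.** There are $N\ge1$ particles $p_1,\dots,p_N$ moving along bonds with unit speed. Particle $p_i$ has position $\mathbf{r}_i(\cdot)\in\mathbb{R}^2$, velocity $\mathbf{v}_i(\cdot)\in\mathbb{R}^2$ (a unit vector in one of the six bond directions), and displacement $\triangle t_i$, where $0=\triangle t_1<\triangle t_2<\dots<\triangle t_N<1$; set $\triangle t_{N+1}=1$, so that time $t+\triangle t_{N+1}$ is time $(t+1)+\triangle t_1$. Particle $p_i$ is at a lattice site exactly at the times $t+\triangle t_i$, $t$ an integer. Every site $\mathbf{h}\in\mathbb{T}$ carries a scatterer with orientation $C(s,\mathbf{h})\in\{-1,1\}$ at time $s$ ($-1$: left rotator; $1$: right rotator). An initial condition is $I=(\bar{\mathbf{r}},\bar{\mathbf{v}},C)$, with $\bar{\mathbf r}=(\mathbf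 r_1,\dots,\mathbf r_N)$ and $\bar{\mathbf v}=(\mathbf v_1,\dots,\mathbf v_N)$ the positions and velocities at time $0$ (with $\mathbf{r}_i+\triangle t_i\mathbf{v}_i\in\mathbb{T}$) and $C=C(0,\cdot)$ the configuration at time $0$. Here $\mathbf{v}_i(t+\triangle t_i)$ and $C(t+\triangle t_i,\cdot)$ denote values just before $p_i$ is scattered at that time. For integers $t$ and $1\le i\le N$, $1\le j\le N$ the dynamics are: - $\mathbf{v}_i(t+\triangle t_{j+1})=R[C(t+\triangle t_i,\mathbf{r}_i(t+\triangle t_i))]\,\mathbf{v}_i(t+\triangle t_i)$ if $j=i$, and $=\mathbf{v}_i(t+\triangle t_j)$ otherwise; - $\mathbf{r}_i(t+\triangle t_{j+1})=\mathbf{r}_i(t+\triangle t_j)+(\triangle t_{j+1}-\triangle t_j)\,\mathbf{v}_i(t+\triangle t_{j+1})$; - $C(t+\triangle t_{j+1},\mathbf{h})=-C(t+\triangle t_j,\mathbf{h})$ if $\mathbf{h}=\mathbf{r}_j(t+\triangle t_j)$, and $=C(t+\triangle t_j,\mathbf{h})$ otherwise; where $R[z]=\begin{pmatrix}\cos(2\pi z/3)&\sin(2\pi z/3)\\-\sin(2\pi z/3)&\cos(2\pi z/3)\end{pmatrix}$ for $z\in\{-1,1\}$. Thus a particle arriving at a left (right) rotator has its velocity rotated by $2\pi/3$ to its left (right), and the rotator then flips orientation; particles do not otherwise interact. At other real times positions are given by linear motion, and velocities and configuration are left-continuous (constant between scattering times). **Negative times.** Each forward step is invertible, so the state at time $0$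 determines a unique two-sided evolution satisfying the equations above for all $t\in\mathbb{Z}$; the state at negative times is this backward evolution. **Bounded.** The trajectory of each particle is bounded for $t\ge0$ (for all time) if there is a subset $\Omega$ of the lattice with finitely many sites, together with the bonds between them, in which every particle remains for all $t\ge0$ (for all $t\in(-\infty,\infty)$). **Periodic.** The model is periodic for $t\ge 0$ (for all time) if there is $\tau>0$ such that $\bar{\mathbf r}(t+\tau)=\bar{\mathbf r}(t)$, $\bar{\mathbf v}(t+\tau)=\bar{\mathbf v}(t)$ and $C(t+\tau,\cdot)=C(t,\cdot)$ for all $t\ge0$ (for all $t\in(-\infty,\infty)$). *)

(* Defs.v *)
From HB Require Import structures.
From mathcomp Require Import all_boot all_order all_algebra.
From mathcomp Require Import all_classical all_reals all_analysis.

Set Implicit Arguments.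
Unset Strict Implicit.
Unset Printing Implicit Defensive.

Import Order.TTheory GRing.Theory Num.Theory.

Local Open Scope classical_set_scope.
Local Open Scope ring_scope.

Definition vec2 (R : realType) (x y : R) : 'cV[R]_2 :=
  \col_(k < 2) (if k == 0 then x else y).

(* The library norm on matrices is the sup norm, hence this definition. *)
Definition enorm (R : realType) (u : 'cV[R]_2) : R :=
  Num.sqrt (u 0 0 ^+ 2 + u 1 0 ^+ 2).

Definition sites (R : realType) : set 'cV[R]_2 :=
  [set h | exists a b : int,
     h = a%:~R *: vec2 1 0 + b%:~R *: vec2 (1 / 2) (Num.sqrt 3 / 2)].

Definition adjacent (R : realType) (h h' : 'cV[R]_2) : Prop :=
  [/\ sites h, sites h' & enorm (h' - h) = 1].

Definition bond (R : realType) (h h' : 'cV[R]_2) : set 'cV[R]_2 :=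
  [set h + s *: (h' - h) | s in [set s : R | 0 <= s <= 1]].

Definition bond_direction (R : realType) (u : 'cV[R]_2) : Prop :=
  exists h h' : 'cV[R]_2, adjacent h h' /\ u = h' - h.

(* z = 1 rotates clockwise (to the right), z = -1 counterclockwise. *)
Definition rotation (R : realType) (z : int) : 'M[R]_2 :=
  let a := 2 * pi * z%:~R / 3 in
  \matrix_(k < 2, l < 2)
    (if k == 0 then (if l == 0 then cos a else sin a)
     else (if l == 0 then - sin a else cos a)).

(* The N displacements occupy the indices 0, ..., N-1 of 'I_N.+1; the last
   index N carries the conventional value 1. *)
Definition displacements (R : realType) (N : nat) (dt : 'I_N.+1 -> R) : Prop :=
  [/\ dt ord0 = 0, dt ord_max = 1 &
      forall i j : 'I_N.+1, (i < j)%N -> dt i < dt j].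

(* time dt t j and time_next dt t j are the times t + dt_j and t + dt_(j+1). *)
Definition time (R : realType) (N : nat) (dt : 'I_N.+1 -> R)
    (t : int) (j : 'I_N) : R :=
  t%:~R + dt (widen_ord (leqnSn N) j).

Definition time_next (R : realType) (N : nat) (dt : 'I_N.+1 -> R)
    (t : int) (j : 'I_N) : R :=
  t%:~R + dt (lift ord0 j).

(* Configurations are functions on the whole plane of which only the values
   at lattice sites are ever constrained. *)
Definition initial_condition (R : realType) (N : nat) (dt : 'I_N.+1 -> R)
    (r0 v0 : 'I_N -> 'cV[R]_2) (C0 : 'cV[R]_2 -> int) : Prop :=
  [/\ forall i, bond_direction (v0 i),
      forall i, sites (r0 i + dt (widen_ord (leqnSn N) i) *: v0 i) &
      forall h, sites h -> C0 h = -1 \/ C0 h = 1].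

(* The two-sided evolution of an initial condition. At a scattering time, the
   values of v and C are those just before the scattering. *)
Record evolution (R : realType) (N : nat) (dt : 'I_N.+1 -> R)
    (r0 v0 : 'I_N -> 'cV[R]_2) (C0 : 'cV[R]_2 -> int)
    (r v : R -> 'I_N -> 'cV[R]_2) (C : R -> 'cV[R]_2 -> int) : Prop := {
  evolution_r0 : forall i, r 0 i = r0 i;
  evolution_v0 : forall i, v 0 i = v0 i;
  evolution_C0 : forall h, sites h -> C 0 h = C0 h;
  evolution_v : forall (t : int) (i j : 'I_N),
    v (time_next dt t j) i =
      if j == i
      then rotation R (C (time dt t i) (r (time dt t i) i))
             *m v (time dt t i) i
      else v (time dt t j) i;
  evolution_r : forall (t : int) (i j : 'I_N),
    r (time_next dt t j) i =
      r (time dt t j) i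
      + (time_next dt t j - time dt t j) *: v (time_next dt t j) i;
  evolution_C : forall (t : int) (j : 'I_N) (h : 'cV[R]_2), sites h ->
    C (time_next dt t j) h =
      if h == r (time dt t j) j then - C (time dt t j) h
      else C (time dt t j) h;
  (* linear motion and left-continuity between scattering times *)
  evolution_r_between : forall (t : int) (i j : 'I_N) (s : R),
    time dt t j < s <= time_next dt t j ->
    r s i = r (time dt t j) i + (s - time dt t j) *: v (time_next dt t j) i;
  evolution_v_between : forall (t : int) (i j : 'I_N) (s : R),
    time dt t j < s <= time_next dt t j ->
    v s i = v (time_next dt t j) i;
  evolution_C_between : forall (t : int) (j : 'I_N) (s : R) (h : 'cV[R]_2),
    time dt t j < s <= time_next dt t j -> sites h ->
    C s h = C (time_next dt t j) h
}.

Definition sublattice (R : realType) (S : set 'cV[R]_2) : set 'cV[R]_2 :=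
  S `|` [set x | exists h h', [/\ S h, S h', adjacent h h' & bond h h' x]].

Definition bounded_during (R : realType) (N : nat) (D : set R)
    (r : R -> 'I_N -> 'cV[R]_2) : Prop :=
  exists S : set 'cV[R]_2,
    [/\ finite_set S, S `<=` @sites R &
        forall t, D t -> forall i, sublattice S (r t i)].

Definition periodic_during (R : realType) (N : nat) (D : set R)
    (r v : R -> 'I_N -> 'cV[R]_2) (C : R -> 'cV[R]_2 -> int) : Prop :=
  exists2 tau : R, 0 < tau &
    forall t, D t ->
      [/\ forall i, r (t + tau) i = r t i,
          forall i, v (t + tau) i = v t i &
          forall h, sites h -> C (t + tau) h = C t h].

(* Main.v *)
(* A bounded forward trajectory has only finitely many states at integer times:
   each state consists of the next site and the velocity of every particle and
   of the rotators within reach, all the others being frozen for t >= 0. Two of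
   these states coincide, and since a step of the dynamics is reversible the
   coincidence propagates in both directions, so that the evolution is periodic
   for all time with an integer period. Conversely, a periodic trajectory is
   determined by a bounded window of time, in which it visits finitely many
   bonds; there the period may be any positive real. *)

Require Import Defs.
From HB Require Import structures.
From mathcomp Require Import all_boot all_order all_algebra.
From mathcomp Require Import all_classical all_reals all_analysis.
From mathcomp Require Import ring lra zify.

Import Order.TTheory GRing.Theory Num.Theory.

Local Open Scope classical_set_scope.
Local Open Scope ring_scope.

(** * Geometry of the triangular lattice and rotations by a third of a turn *)

Section Lattice.
Set Implicit Arguments.
Unset Strict Implicit.
Context {R : realType}.
Implicit Types (u w h : 'cV[R]_2) (z : int).

Lemma col2P u w : u 0 0 = w 0 0 -> u 1 0 = w 1 0 -> u = w.
Proof.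
move=> e0 e1; apply/colP => -[[|[|//]] lt2].
  by rewrite (_ : Ordinal lt2 = 0) //; apply: val_inj.
by rewrite (_ : Ordinal lt2 = 1) //; apply: val_inj.
Qed.

Lemma sitesP u : sites u <-> exists a b : int,
  u 0 0 = a%:~R + b%:~R / 2 /\ u 1 0 = b%:~R * (Num.sqrt 3 / 2).
Proof.
split=> -[a [b]]; rewrite /vec2.
  by move=> ->; exists a, b; rewrite !mxE /=; split; ring.
by case=> e0 e1; exists a, b; apply: col2P; rewrite !mxE /= ?e0 ?e1; ring.
Qed.

Lemma sites0 : sites (0 : 'cV[R]_2).
Proof. by apply/sitesP; exists 0, 0; rewrite !mxE; split; ring. Qed.

Lemma sitesB u w : sites u -> sites w -> sites (u - w).
Proof.
move=> /sitesP[a [b [u0 u1]]] /sitesP[c [d [w0 w1]]]; apply/sitesP.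
by exists (a - c), (b - d); rewrite !mxE u0 u1 w0 w1 !rmorphB /=; split; ring.
Qed.

Lemma sitesD u w : sites u -> sites w -> sites (u + w).
Proof.
by move=> su sw; rewrite -[w]opprK; apply: sitesB; rewrite // -sub0r;
  apply: sitesB => //; exact: sites0.
Qed.

Lemma bond_directionP u : bond_direction u <-> sites u /\ enorm u = 1.
Proof.
split=> [[h [h' [[sh sh' e1] ->]]]|[su e1]]; first by split=> //; exact: sitesB.
by exists 0, u; split; [split; rewrite ?subr0 //; exact: sites0|rewrite subr0].
Qed.

Lemma bond_direction_sites u : bond_direction u -> sites u.
Proof. by case/bond_directionP. Qed.

Lemma adjacent_bond_direction h u :
  sites h -> bond_direction u -> Defs.adjacent (h - u) h.
Proof.
move=> sh /bond_directionP[su eu]; split=> //; first exact: sitesB.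
by rewrite opprB addrC subrK.
Qed.

Lemma norm_bond_direction u k : bond_direction u -> `|u k 0| <= 1.
Proof.
case/bond_directionP=> _ e1; have ge0 (x : R) : 0 <= x ^+ 2 by exact: sqr_ge0.
have: u 0 0 ^+ 2 + u 1 0 ^+ 2 = 1.
  rewrite -[LHS]sqr_sqrtr ?addr_ge0 ?ge0 //.
  by move: e1; rewrite /enorm => ->; rewrite expr1n.
rewrite -(ler_pXn2r (n := 2)) ?nnegrE // expr1n real_normK ?num_real //.
have := ge0 (u 0 0); have := ge0 (u 1 0); move: k => [[|[|//]] lt2].
  by rewrite (_ : Ordinal lt2 = 0); [lra|apply: val_inj].
by rewrite (_ : Ordinal lt2 = 1); [lra|apply: val_inj].
Qed.

(** For [x = 2 * pi / 3], the double of [x] is [- x] up to a full turn, so the double-angle formula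
    gives [2 * cos x = -1] because [sin x] is positive. *)
Lemma cos_sin_2pi3 : cos (2 * pi / 3) = - 1 / 2 :> R /\
  sin (2 * pi / 3) = Num.sqrt 3 / 2 :> R.
Proof.
set x : R := 2 * pi / 3; have pi0 := @pi_gt0 R.
have s0 : 0 < sin x by apply: sin_gt0_pi; rewrite /x; apply/andP; split; lra.
have cE : cos x = - 1 / 2.
  have: sin (x *+ 2) = - sin x.
    rewrite -sinN -[RHS]sinD2pi; congr sin; rewrite /x !mulr2n; lra.
  rewrite sin_mulr2n mulr2n => e.
  have /eqP : sin x * (2 * cos x + 1) = 0 by move: e; lra.
  by rewrite mulf_eq0 gt_eqF //= => /eqP; lra.
have s2 : 0 <= Num.sqrt 3 / 2 :> R by rewrite divr_ge0 ?sqrtr_ge0.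
split=> //; apply/eqP; rewrite -(eqrXn2 (ltn0Sn 1) (ltW s0) s2).
by rewrite sin2cos2 cE !expr_div_n sqr_sqrtr //; apply/eqP; lra.
Qed.

Lemma rotation_mulE z u : z = -1 \/ z = 1 ->
  (rotation R z *m u) 0 0 = - u 0 0 / 2 + z%:~R * (Num.sqrt 3 / 2) * u 1 0 /\
  (rotation R z *m u) 1 0 = - z%:~R * (Num.sqrt 3 / 2) * u 0 0 - u 1 0 / 2.
Proof.
move=> hz; have [cE sE] := cos_sin_2pi3.
have [cz sz] : cos (2 * pi * z%:~R / 3) = - 1 / 2 :> R /\
    sin (2 * pi * z%:~R / 3) = z%:~R * (Num.sqrt 3 / 2) :> R.
  case: hz => ->; last by rewrite mulr1 mul1r.
  by rewrite rmorphN /= mulrN1 !mulNr cosN sinN cE sE; split; ring.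
by rewrite /rotation !mxE !big_ord_recl !big_ord0 !mxE /= cz sz;
  rewrite (_ : lift 0 0 = 1); [split; ring|apply: val_inj].
Qed.

(** The flipped orientation undoes the turn; this is what makes a scattering reversible. *)
Lemma rotationNK z u : z = -1 \/ z = 1 ->
  rotation R (- z) *m (rotation R z *m u) = u.
Proof.
move=> hz; have hNz : - z = -1 \/ - z = 1 by case: hz => ->; [right|left].
have [e0 e1] := rotation_mulE u hz.
have [f0 f1] := rotation_mulE (rotation R z *m u) hNz.
have s3 : Num.sqrt 3 ^+ 2 = 3 :> R by rewrite sqr_sqrtr.
have zz : z%:~R ^+ 2 = 1 :> R.
    by case: hz => ->; rewrite ?rmorphN ?sqrrN expr1n.
apply: col2P; rewrite ?f0 ?f1 e0 e1 rmorphN /=.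
  transitivity (u 0 0 / 4 + z%:~R ^+ 2 * Num.sqrt 3 ^+ 2 / 4 * u 0 0);
    first by field.
  by rewrite s3 zz; field.
transitivity (u 1 0 / 4 + z%:~R ^+ 2 * Num.sqrt 3 ^+ 2 / 4 * u 1 0);
    first by field.
by rewrite s3 zz; field.
Qed.

Lemma bond_direction_rotation z u : z = -1 \/ z = 1 ->
  bond_direction u -> bond_direction (rotation R z *m u).
Proof.
move=> hz /bond_directionP[su eu]; apply/bond_directionP.
have [e0 e1] := rotation_mulE u hz.
have s3 : Num.sqrt 3 ^+ 2 = 3 :> R by rewrite sqr_sqrtr.
split; last first.
  have zz : z%:~R ^+ 2 = 1 :> R.
    by case: hz => ->; rewrite ?rmorphN ?sqrrN expr1n.
  rewrite -eu /enorm e0 e1; congr Num.sqrt.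
  transitivity ((1 + z%:~R ^+ 2 * Num.sqrt 3 ^+ 2) / 4 *
      (u 0 0 ^+ 2 + u 1 0 ^+ 2)).
    by field.
  by rewrite s3 zz; field.
have /sitesP[a [b [u0 u1]]] := su; apply/sitesP; rewrite e0 e1 u0 u1.
(* In lattice coordinates a left turn maps (a, b) to (-a - b, a), and a right turn maps it to (b, -a
   - b). *)
case: hz => ->.
- exists (- a - b), a; rewrite !(rmorphB, rmorphN) /=; split; last by field.
  transitivity (- a%:~R / 2 - (1 + Num.sqrt 3 ^+ 2) / 4 * b%:~R : R);
    first by field.
  by rewrite s3; field.
- exists b, (- (a + b)); rewrite !(rmorphN, rmorphD) /=; split; last by field.
  transitivity (- a%:~R / 2 + (Num.sqrt 3 ^+ 2 - 1) / 4 * b%:~R : R);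
    first by field.
  by rewrite s3; field.
Qed.

(** The second coordinate, [b] times [sqrt 3 / 2], bounds [b] by [2 * K] since [sqrt 3 >= 1]; the
    first, [a + b / 2], then bounds [a] by [2 * K]. So [f], which shifts indices by [M] to reach the
    integers from [-M] to [M], covers all these sites. *)
Lemma finite_sites_norm_le (K : R) :
  finite_set [set h | sites h /\ forall k, `|h k 0| <= K].
Proof.
pose M := (Num.truncn (2 * K)).+1.
pose f (p : 'I_(M.*2.+1) * 'I_(M.*2.+1)) : 'cV[R]_2 :=
  (p.1%:Z - M%:Z)%:~R *: vec2 1 0 +
  (p.2%:Z - M%:Z)%:~R *: vec2 (1 / 2) (Num.sqrt 3 / 2).
apply: (sub_finite_set _ (finite_image f (finite_finset (X := setT)))).
move=> h [sh hK]; have KM : 2 * K < M%:R by exact: truncnS_gt.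
have s1 : 1 <= Num.sqrt 3 :> R by rewrite -[leLHS]sqrtr1 ler_sqrt //; lra.
have key (c : int) : `|c%:~R| <= 2 * K ->
    exists i : 'I_(M.*2.+1), i%:Z - M%:Z = c.
  move=> cK; have: (`|c| < M%:Z)%R.
    by rewrite -(ltr_int R) intr_norm (le_lt_trans cK).
  move=> cM; have lt : (absz (c + M%:Z)%R < M.*2.+1)%N by lia.
  by exists (Ordinal lt) => /=; clear -cM; lia.
have [a [b hE]] := sh.
have h0 : h 0 0 = a%:~R + b%:~R / 2 by rewrite hE !mxE /=; ring.
have h1 : h 1 0 = b%:~R * (Num.sqrt 3 / 2) by rewrite hE !mxE /=; ring.
have hb : `|b%:~R : R| <= 2 * K.
  have := hK 1; rewrite h1 normrM [`|Num.sqrt 3 / 2|]ger0_norm; last first.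
    by rewrite divr_ge0 ?sqrtr_ge0.
  by have := normr_ge0 (b%:~R : R); nra.
have ha : `|a%:~R : R| <= 2 * K.
  by have := hK 0; rewrite h0; move: hb; rewrite !ler_norml; lra.
have [i iE] := key a ha; have [j jE] := key b hb.
by exists (i, j); rewrite // /f /= iE jE.
Qed.

(** A point of a bond is a convex combination of the two ends, so a bound on the sites of [S]
    suffices. *)
Lemma sublattice_norm_le (S : set 'cV[R]_2) : finite_set S ->
  exists K : R, forall x, Defs.sublattice S x -> forall k, `|x k 0| <= K.
Proof.
move=> /finite_seqP[l ->]; pose K : R := \sum_(h <- l) \sum_k `|h k 0|.
have lK h k : h \in l -> `|h k 0| <= K.
  move=> hl; rewrite /K (big_rem h) //= (bigD1 k) //= -addrA lerDl.
  by rewrite addr_ge0 ?sumr_ge0 // => x _; rewrite sumr_ge0.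
exists K => x [/= /lK //|[h [h' [/= hl h'l _ [a /andP[a0 a1] <-]]]]] k.
rewrite !mxE; have := lK h k hl; have := lK h' k h'l; rewrite !ler_norml.
by move=> /andP[? ?] /andP[? ?]; apply/andP; split; nra.
Qed.

End Lattice.

Lemma pigeonhole (T : finType) (f : nat -> T) :
  exists m n, (m < n)%N /\ f m = f n.
Proof.
pose g (i : 'I_#|T|.+1) := f i.
have /injectivePn[i [j ij gij]] : ~~ injectiveb g.
  by apply/negP => /injectiveP/leq_card; rewrite card_ord ltnn.
have [lt|gt|/val_inj eqij] := ltngtP i j; first by exists i, j.
  by exists j, i.
by rewrite eqij eqxx in ij.
Qed.

(** * The clock: scattering times of all rounds, in order *)

Section Clock.
Set Implicit Arguments.
Unset Strict Implicit.
Context {R : realType} {N : nat}.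
Context (dt : 'I_N.+1 -> R) (hdt : displacements dt).

(** Natural indices let [k.+1] range up to [N] without casts between ordinals; only [k <= N] is
    meaningful. *)
Definition disp (k : nat) : R := dt (inord k).

Definition tick (t : int) (k : nat) : R := t%:~R + disp k.

Lemma disp0 : disp 0 = 0.
Proof.
by have [d0 _ _] := hdt; rewrite /disp -[RHS]d0; congr dt; apply: val_inj;
  rewrite /= inordK.
Qed.

Lemma dispN : disp N = 1.
Proof.
by have [_ d1 _] := hdt; rewrite /disp -[RHS]d1; congr dt; apply: val_inj;
  rewrite /= inordK.
Qed.

Lemma disp_lt k l : (k < l <= N)%N -> disp k < disp l.
Proof.
have [_ _ dlt] := hdt => /andP[kl lN]; apply: dlt; rewrite !inordK //.
by rewrite ltnS (leq_trans (ltnW kl)).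
Qed.

Lemma disp_le k l : (k <= l <= N)%N -> disp k <= disp l.
Proof.
move=> /andP[]; rewrite leq_eqVlt => /orP[/eqP -> //|kl lN].
by rewrite ltW // disp_lt // kl.
Qed.

Lemma disp_ge0 k : (k <= N)%N -> 0 <= disp k.
Proof. by move=> kN; rewrite -disp0 disp_le. Qed.

Lemma disp_le1 k : (k <= N)%N -> disp k <= 1.
Proof. by move=> kN; rewrite -dispN disp_le // kN leqnn. Qed.

Lemma widen_disp (i : 'I_N) : dt (widen_ord (leqnSn N) i) = disp i.
Proof.
by congr dt; apply: val_inj; rewrite /= inordK // ltnS ltnW.
Qed.

Lemma time_tick t (j : 'I_N) : Defs.time dt t j = tick t j.
Proof. by rewrite /Defs.time widen_disp. Qed.

Lemma time_next_tick t (j : 'I_N) : time_next dt t j = tick t j.+1.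
Proof.
congr (_ + dt _); apply: val_inj => /=.
by rewrite inordK // ltnS.
Qed.

Lemma tickN t : tick t N = tick (t + 1) 0.
Proof. by rewrite /tick disp0 dispN rmorphD /= addr0. Qed.

Lemma tick0 t : tick t 0 = t%:~R.
Proof. by rewrite /tick disp0 addr0. Qed.

Lemma tickD t p k : tick (t + p) k = tick t k + p%:~R.
Proof. by rewrite /tick rmorphD /= addrAC. Qed.

Lemma tickB t k l : tick t k - tick t l = disp k - disp l.
Proof. by rewrite /tick; ring. Qed.

(** The intervals are closed on the right, to match left-continuity. Hence the ceiling of [s] gives
    its round, and the least tick at or after [s] gives the step. *)
Lemma tick_cover (s : R) :
  exists (t : int) (j : 'I_N), tick t j < s <= tick t j.+1.
Proof.
pose t : int := Num.ceil s - 1; exists t.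
have /andP[ts st] : t%:~R < s <= (t + 1)%:~R.
  by rewrite /t subrK; exact: ceil_itv.
have [k kE kmin] : exists2 k, (k <= N)%N && (s <= tick t k) &
    forall l, (l <= N)%N && (s <= tick t l) -> (k <= l)%N.
  have ex : exists k, (k <= N)%N && (s <= tick t k).
    by exists N; rewrite leqnn tickN tick0.
  by exists (ex_minn ex); case: ex_minnP.
case: k kE kmin => [|k]; first by rewrite tick0 leNgt ts andbF.
move=> /andP[kN sk] kmin; exists (Ordinal kN) => /=; rewrite sk andbT ltNge.
apply/negP => sk'; have := kmin k.
by rewrite ltnn sk' (ltnW kN) => /(_ isT).
Qed.

(** The hypotheses are equivalences, so that [P] spreads from the start of round [t0] into the past
    as well as the future. *)
Lemma clock_ind (P : int -> nat -> Prop) (t0 : int) :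
  (forall t k, (k < N)%N -> P t k <-> P t k.+1) ->
  (forall t, P t N <-> P (t + 1) 0%N) ->
  P t0 0%N -> forall t k, (k <= N)%N -> P t k.
Proof.
move=> step wrap P0.
have round t k : (k <= N)%N -> P t 0%N <-> P t k.
  by elim: k => [//|k IH] kN; exact: iff_trans (IH (ltnW kN)) (step t k kN).
have next t : P t 0%N <-> P (t + 1) 0%N.
  exact: iff_trans (round t N (leqnn N)) (wrap t).
suff all0 t : P t 0%N by move=> t k kN; exact/(round t k kN).
have fwd (n : nat) : P (t0 + n%:Z) 0%N.
  elim: n => [|n IH]; first by rewrite addr0.
  by rewrite (_ : _ + _ = t0 + n%:Z + 1); [exact: (iffLR (next _) IH)|lia].
have bwd (n : nat) : P (t0 - n%:Z) 0%N.
  elim: n => [|n IH]; first by rewrite subr0.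
  apply: (iffRL (next _)).
  by rewrite (_ : _ + 1 = t0 - n%:Z); [exact: IH|lia].
have [le|/ltW le] := leP t0 t.
  by rewrite (_ : t = t0 + `|t - t0|%N%:Z); [exact: fwd|lia].
by rewrite (_ : t = t0 - `|t - t0|%N%:Z); [exact: bwd|lia].
Qed.

End Clock.

(** * Time left until a particle reaches its next site *)

Section Delay.
Set Implicit Arguments.
Unset Strict Implicit.
Context {R : realType} {N : nat}.
Context (dt : 'I_N.+1 -> R) (hdt : displacements dt).

(* The time that separates the k-th scattering time of a round from the next
   one at which p_i is at a site. *)
Definition delay (i k : nat) : R := disp dt i - disp dt k + (i < k)%N%:R.

Lemma delay_id i : delay i i = 0.
Proof. by rewrite /delay ltnn subrr addr0. Qed.

Lemma delayS i k : i <> k ->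
  delay i k = disp dt k.+1 - disp dt k + delay i k.+1.
Proof.
move=> ik; rewrite /delay (_ : (i < k.+1)%N = (i < k)%N); first by ring.
by apply/idP/idP; lia.
Qed.

Lemma delay_idS k : delay k k.+1 = 1 - (disp dt k.+1 - disp dt k).
Proof. by rewrite /delay ltnSn mulr1n; ring. Qed.

Lemma delayN i : (i < N)%N -> delay i N = delay i 0.
Proof.
move=> iN; rewrite /delay iN (disp0 hdt) (dispN hdt) ltn0 mulr1n mulr0n.
by ring.
Qed.

Lemma delay0 i : delay i 0 = disp dt i.
Proof. by rewrite /delay (disp0 hdt) subr0 addr0. Qed.

Lemma delay_ge0 i k : (i < N)%N -> (k <= N)%N -> 0 <= delay i k.
Proof.
move=> iN kN; rewrite /delay; case: ltnP => ik.
  have := disp_le1 hdt kN; have := disp_ge0 hdt (ltnW iN).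
  by rewrite mulr1n; lra.
by rewrite addr0 subr_ge0 (disp_le hdt) // ik ltnW.
Qed.

(** The sum is the time from just after tick [k] to the next arrival of [p_i]. Being at most 1, it
    keeps the particle on a single bond during the step. *)
Lemma delayS_le1 i k : (i < N)%N -> (k < N)%N ->
  delay i k.+1 + (disp dt k.+1 - disp dt k) <= 1.
Proof.
move=> iN kN; rewrite /delay; case: ltnP => ik.
  have : disp dt i <= disp dt k by rewrite (disp_le hdt) // -ltnS ik ltnW.
  by rewrite mulr1n; lra.
have := disp_le1 hdt (ltnW iN); have := disp_ge0 hdt (ltnW kN).
by rewrite mulr0n; lra.
Qed.

End Delay.

(** * The evolution through next sites, and its invariant *)

Section Evolution.
Set Implicit Arguments.
Unset Strict Implicit.
Context {R : realType} {N : nat}.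
Context (dt : 'I_N.+1 -> R) (hdt : displacements dt).
Context (r0 v0 : 'I_N -> 'cV[R]_2) (C0 : 'cV[R]_2 -> int).
Context (hI : initial_condition dt r0 v0 C0).
Context (r v : R -> 'I_N -> 'cV[R]_2) (C : R -> 'cV[R]_2 -> int).
Context (hE : evolution dt r0 v0 C0 r v C).

Local Notation tick := (tick dt).
Local Notation disp := (disp dt).
Local Notation delay := (delay dt).

Lemma v_tickS t (i k : 'I_N) : v (tick t k.+1) i =
  if k == i then rotation R (C (tick t i) (r (tick t i) i)) *m v (tick t i) i
  else v (tick t k) i.
Proof. by have := evolution_v hE t i k; rewrite !time_tick time_next_tick. Qed.

Lemma r_tickS t (i k : 'I_N) : r (tick t k) i =
  r (tick t k.+1) i - (disp k.+1 - disp k) *: v (tick t k.+1) i.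
Proof.
have := evolution_r hE t i k; rewrite !time_tick time_next_tick => ->.
by rewrite tickB addrK.
Qed.

Lemma C_tickS t (k : 'I_N) h : sites h -> C (tick t k.+1) h =
  if h == r (tick t k) k then - C (tick t k) h else C (tick t k) h.
Proof.
by move=> sh; have := evolution_C hE t k sh; rewrite !time_tick time_next_tick.
Qed.

(** A discrete substitute for the position: the first site that [p_i] meets from this tick on, the
    present one included. It changes only when [p_i] is scattered. *)
Definition next_site t k i := r (tick t k) i + delay i k *: v (tick t k) i.

(** At time 0 these are the requirements of [initial_condition]; [regularP] carries them to every
    tick. *)
Definition regular t k :=
  [/\ forall i, bond_direction (v (tick t k) i),
      forall i, sites (next_site t k i) &
      forall h, sites h -> C (tick t k) h = -1 \/ C (tick t k) h = 1].

Lemma next_siteS t (i k : 'I_N) : k <> i ->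
  next_site t k.+1 i = next_site t k i.
Proof.
move=> ki; rewrite /next_site r_tickS v_tickS.
case: eqP => // _; rewrite (@delayS _ _ dt i k); last by move=> /ord_inj /esym.
move: (disp k.+1 - disp k) => d.
by rewrite [(d + _) *: _]scalerDl [RHS]addrA subrK.
Qed.

Lemma next_site_idS t (k : 'I_N) :
  next_site t k.+1 k = next_site t k k + v (tick t k.+1) k.
Proof.
rewrite /next_site (r_tickS t k k) delay_id delay_idS scale0r addr0.
by rewrite scalerBl scale1r addrA addrAC.
Qed.

Lemma regular_tickS t k : (k < N)%N -> regular t k <-> regular t k.+1.
Proof.
move=> kN; pose j := Ordinal kN; rewrite -[k]/(j : nat); split.
  case=> dv sr sC; have sj : sites (r (tick t j) j).
    by have := sr j; rewrite /next_site delay_id scale0r addr0.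
  have dv' i : bond_direction (v (tick t j.+1) i).
    rewrite v_tickS; case: eqP => // <-.
    by apply: bond_direction_rotation => //; exact: sC.
  split=> // [i|h sh].
    have [<-|/eqP ji] := eqVneq j i; last by rewrite next_siteS.
    by rewrite next_site_idS; apply: sitesD => //; exact: bond_direction_sites.
  rewrite C_tickS //; case: ifP => _; last exact: sC.
  by case: (sC h sh) => ->; rewrite ?opprK; [right|left].
(* Backwards, orientations and sites are recovered before velocities: undoing a rotation needs an
   orientation -1 or 1, known only at sites. *)
case=> dv sr sC; have sC' h : sites h ->
    C (tick t j) h = -1 \/ C (tick t j) h = 1.
  move=> sh; have := sC h sh; rewrite C_tickS //; case: ifP => // _.
  by case=> /eqP; rewrite eqr_oppLR ?opprK => /eqP ->; [right|left].
have sr' i : sites (next_site t j i).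
  have [<-|/eqP ji] := eqVneq j i; last by rewrite -next_siteS.
  rewrite -[next_site _ _ _](addrK (v (tick t j.+1) j)) -next_site_idS.
  by apply: sitesB => //; exact: bond_direction_sites.
split=> // i; have := dv i; rewrite v_tickS; case: eqP => // <-.
have sj : sites (r (tick t j) j).
  by have := sr' j; rewrite /next_site delay_id scale0r addr0.
have hz := sC' _ sj; rewrite -{2}[v _ _](rotationNK _ hz).
apply: bond_direction_rotation.
by case: hz => ->; rewrite ?opprK; [right|left].
Qed.

Lemma next_siteN t i : next_site t N i = next_site (t + 1) 0 i.
Proof. by rewrite /next_site tickN // delayN. Qed.

Lemma regularP t k : (k <= N)%N -> regular t k.
Proof.
apply: (clock_ind (t0 := 0)); first exact: regular_tickS.
  move=> {}t; rewrite /regular tickN //.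
  by split=> -[dv sr sC]; split=> // i; move: (sr i); rewrite next_siteN.
have [dv sr sC] := hI; split=> [i|i|h sh]; rewrite ?/next_site tick0 //.
- by rewrite (evolution_v0 hE).
- by rewrite (evolution_v0 hE) (evolution_r0 hE) delay0 // -widen_disp.
- by rewrite (evolution_C0 hE) //; exact: sC.
Qed.

Lemma r_tick_site t (j : 'I_N) : sites (r (tick t j) j).
Proof.
have [_ /(_ j) + _] := regularP t (ltnW (ltn_ord j)).
by rewrite /next_site delay_id scale0r addr0.
Qed.

(** * Determinism in both directions of time *)

Definition same_state s s' :=
  [/\ forall i, r s i = r s' i, forall i, v s i = v s' i &
      forall h, sites h -> C s h = C s' h].

(** At equal [k] the same particle is scattered. Backwards, the later positions and velocities give
    the earlier positions, hence the site that flipped, hence the earlier configuration, and finally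
    the rotation to undo. *)
Lemma same_state_tickS t t' k : (k < N)%N ->
  same_state (tick t k) (tick t' k) <-> same_state (tick t k.+1) (tick t' k.+1).
Proof.
move=> kN; pose j := Ordinal kN; rewrite -[k]/(j : nat); split=> -[er ev eC].
  have ev' i : v (tick t j.+1) i = v (tick t' j.+1) i.
    rewrite !v_tickS; case: eqP => // <-.
    by rewrite -er -ev eC //; exact: r_tick_site.
  split=> // [i|h sh]; last by rewrite !C_tickS // er eC.
  by have := er i; rewrite !(r_tickS _ i j) ev' => /addIr.
have er' i : r (tick t j) i = r (tick t' j) i by rewrite !(r_tickS _ i j) er ev.
have eC' h : sites h -> C (tick t j) h = C (tick t' j) h.
  move=> sh; have := eC h sh; rewrite !C_tickS // er'.
  by case: ifP => // _ /oppr_inj.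
split=> // i; have := ev i; rewrite !v_tickS; case: eqP => // <-.
have sj := r_tick_site t j; rewrite -er' -(eC' _ sj) => /(congr1 (mulmx _)).
have [_ _ /(_ _ sj) hz] := regularP t (ltnW (ltn_ord j)).
by move=> e; rewrite -[LHS](rotationNK _ hz) e rotationNK.
Qed.

(** One coincidence spreads to all ticks by [clock_ind]; between ticks the state is determined by
    the two neighbouring ticks, whose spacing is the same in every round. *)
Lemma same_state_shift t p : same_state (tick t 0) (tick (t + p) 0) ->
  forall s, same_state s (s + p%:~R).
Proof.
move=> e0 s; have eP : forall t k, (k <= N)%N ->
    same_state (tick t k) (tick (t + p) k).
  apply: (clock_ind (t0 := t)) => //.
    by move=> *; exact: same_state_tickS.
  by move=> {e0}t; rewrite !tickN // addrAC.
have [{e0}t [j hs]] := tick_cover hdt s.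
have hs' : tick (t + p) j < s + p%:~R <= tick (t + p) j.+1.
  by rewrite !tickD ltrD2r lerD2r.
have [er ev eC] := eP t j.+1 (ltn_ord j).
have [er' _ _] := eP t j (ltnW (ltn_ord j)).
move: hs hs'; rewrite -!time_tick -!time_next_tick => hs hs'.
split=> [i|i|h sh].
- rewrite (evolution_r_between hE i hs) (evolution_r_between hE i hs').
  rewrite !time_tick !time_next_tick er' ev tickD; congr (_ + _ *: _).
  by ring.
- rewrite (evolution_v_between hE i hs) (evolution_v_between hE i hs').
  by rewrite !time_next_tick.
- rewrite (evolution_C_between hE hs sh) (evolution_C_between hE hs' sh).
  by rewrite !time_next_tick eC.
Qed.

(** * The bond occupied during a step *)

Lemma r_on_bond t (i j : 'I_N) s : tick t j < s <= tick t j.+1 ->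
  let h := next_site t j.+1 i in
  bond (h - v (tick t j.+1) i) h (r s i).
Proof.
move=> hs /=; have d0 := delay_ge0 hdt (ltn_ord i) (ltn_ord j).
have d1 := delayS_le1 hdt (ltn_ord i) (ltn_ord j).
have /andP[s0 s1] := hs.
(* At unit speed the distance still to cover on the bond is the time left until the next site. *)
exists (1 - (delay i j.+1 + (tick t j.+1 - s))).
  by move: s0 s1 d0 d1; rewrite -(tickB dt t) /=; lra.
move: hs; rewrite -time_tick -time_next_tick => /(evolution_r_between hE i) ->.
rewrite time_tick time_next_tick r_tickS /next_site.
by rewrite -(tickB dt t); apply/colP => k; rewrite !mxE; ring.
Qed.

Lemma next_site_adjacent t k i : (k <= N)%N ->
  Defs.adjacent (next_site t k i - v (tick t k) i) (next_site t k i).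
Proof.
by move=> kN; have [dv sr _] := regularP t kN; apply: adjacent_bond_direction.
Qed.
(** Makes the next site at the start of a round an actual position in that round, so that a bound on
    the trajectory applies to it. *)
Lemma next_site_id t (i : 'I_N) : next_site t 0 i = r (tick t i) i.
Proof.
suff H k : (k <= i)%N -> next_site t 0 i = next_site t k i.
  by rewrite (H i (leqnn _)) /next_site delay_id scale0r addr0.
elim: k => [//|k IH] ki; have kN : (k < N)%N by exact: ltn_trans ki (ltn_ord i).
rewrite (IH (ltnW ki)) -(@next_siteS t i (Ordinal kN)) //.
by move=> e; move: ki; rewrite -e ltnn.
Qed.

(** * Recurrence of a bounded trajectory *)

Lemma bounded_recurrent : bounded_during [set t : R | 0 <= t] r ->
  exists2 p : int, 0 < p & forall s, same_state s (s + p%:~R).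
Proof.
(* The maximum with 1 makes the list [l] below contain the velocities as well as the visited
   sites. *)
move=> [S [/sublattice_norm_le[K SK] _ rS]]; pose L := Num.max K 1.
have /finite_seqP[l lE] := finite_sites_norm_le L.
have lP h : h \in l <-> sites h /\ forall k, `|h k 0| <= L.
  by change ([set` l] h <-> sites h /\ forall k, `|h k 0| <= L); rewrite -lE.
have tick_ge0 (n k : nat) : (k <= N)%N -> 0 <= tick n k.
  by move=> kN; rewrite addr_ge0 ?(disp_ge0 hdt) // ler0n.
have rl (n : nat) (i : 'I_N) : r (tick n i) i \in l.
  apply/lP; split; first exact: r_tick_site.
  move=> k; rewrite /L le_max SK //; apply: rS; apply: tick_ge0.
  exact: ltnW.
have vl (n : nat) (i : 'I_N) : v (tick n 0) i \in l.
  have [dv _ _] := regularP n (leq0n N).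
  apply/lP; split; first exact: bond_direction_sites.
  by move=> k; rewrite /L le_max norm_bond_direction ?orbT.
(* A rotator outside [l] is met by no particle from time 0 on, so it never flips. *)
have Cl (n : nat) h : sites h -> h \notin l -> C (tick n 0) h = C (tick 0 0) h.
  move=> sh hl; elim: n => [//|n <-]; rewrite -addn1 PoszD -tickN //.
  suff H k : (k <= N)%N -> C (tick n k) h = C (tick n 0) h by exact: H.
  elim: k => [//|k IH] kN; rewrite -IH ?(ltnW kN) //.
  rewrite (C_tickS n (Ordinal kN)) // ifF //.
  by apply: contraNF hl => /eqP ->; exact: rl.
(* [inord] asks for a successor bound, hence [(size l).+1]; the extra index reads the default site
   [0]. *)
pose code (n : nat) :=
  ([ffun i => (inord (index (next_site n 0 i) l),
               inord (index (v (tick n 0) i) l))],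
   [ffun x : 'I_(size l).+1 => C (tick n 0) (nth 0 l x) == 1])
  : {ffun 'I_N -> 'I_(size l).+1 * 'I_(size l).+1} *
    {ffun 'I_(size l).+1 -> bool}.
have [m [n [mn [/ffunP eq1 /ffunP eq2]]]] := pigeonhole code.
have inord_index h h' : h \in l -> h' \in l ->
    inord (index h l) = inord (index h' l) :> 'I_(size l).+1 -> h = h'.
  move=> hl h'l /(congr1 val); rewrite /= !inordK ?ltnS ?index_size //.
  by move=> e; rewrite -(nth_index 0 hl) e nth_index.
exists (n%:Z - m%:Z); first by rewrite subr_gt0 ltz_nat.
apply: (same_state_shift (t := m)); rewrite addrC subrK.
have ev i : v (tick m 0) i = v (tick n 0) i.
  by have := eq1 i; rewrite !ffunE => -[_ /inord_index]; apply; exact: vl.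
split=> [i|//|h sh].
  have : next_site m 0 i = next_site n 0 i.
    have := eq1 i; rewrite !ffunE => -[/inord_index + _]; apply;
      by rewrite next_site_id; exact: rl.
  by rewrite /next_site ev => /addIr.
have [hl|hl] := boolP (h \in l); last by rewrite !Cl.
have := eq2 (inord (index h l)).
rewrite !ffunE inordK ?ltnS ?index_size // nth_index //.
(* Orientations are -1 or 1, so the Boolean in the code determines them. *)
have [_ _ /(_ h sh)] := regularP m (leq0n N).
have [_ _ /(_ h sh)] := regularP n (leq0n N).
by move=> [] -> [] ->.
Qed.

(** * From periodicity back to boundedness *)

Lemma bounded_window (M : nat) : bounded_during [set t : R | 0 <= t <= M%:R] r.
Proof.
(* Round -1 is included because time 0 ends its last step. *)
pose f (a : 'I_M.+1 * 'I_N * 'I_N) := next_site (a.1.1%:Z - 1) a.1.2.+1 a.2.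
pose g (a : 'I_M.+1 * 'I_N * 'I_N) :=
  f a - v (tick (a.1.1%:Z - 1) a.1.2.+1) a.2.
have adj a : Defs.adjacent (g a) (f a).
  by apply: next_site_adjacent; exact: ltn_ord.
(* For each particle and each of the finitely many steps, [g] and [f] are the two ends of the bond
   occupied. *)
exists (f @` setT `|` g @` setT); split.
- by rewrite finite_setU; split; apply: finite_image; exact: finite_finset.
- by move=> _ [] [a _ <-]; have [? ? _] := adj a.
move=> s /= /andP[s0 sM] i; have [t [j hs]] := tick_cover hdt s.
have /andP[ts st] := hs; have tlt : (absz (t + 1)%R < M.+1)%N /\ 0 <= t + 1.
  have tM : t%:~R < M%:~R :> R.
    apply: le_lt_trans (lt_le_trans ts sM).
    by rewrite lerDl (disp_ge0 hdt) // ltnW.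
  have t1 : 0 <= (t + 1)%:~R :> R.
    rewrite (le_trans s0) // (le_trans st) // rmorphD /= lerD2l.
    exact: disp_le1.
  move: tM t1; rewrite ltr_int ler0z; lia.
pose a : 'I_M.+1 * 'I_N * 'I_N := (Ordinal tlt.1, j, i).
have tE : a.1.1%:Z - 1 = t by rewrite /=; lia.
right; exists (g a), (f a); split; [by right; exists a|by left; exists a| |].
  exact: adj.
by have := r_on_bond i hs; rewrite /g /f tE.
Qed.

Lemma periodic_bounded : periodic_during [set t : R | 0 <= t] r v C ->
  bounded_during [set t : R | 0 <= t] r.
Proof.
move=> [tau tau0 per].
have iterP n s : 0 <= s -> forall i, r (s + n%:R * tau) i = r s i.
  move=> s0 i; elim: n => [|n IH]; first by rewrite mul0r addr0.
  rewrite -IH -natr1 mulrDl mul1r addrA.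
  have sn : 0 <= s + n%:R * tau by rewrite addr_ge0 // mulr_ge0 // ltW.
  by have [->] := per _ sn.
(* The window has integer length while [tau] is real, so [tau] is rounded up; any [t >= 0] is then
   reduced modulo [tau] into it. *)
have [S [finS sS rS]] := bounded_window (Num.truncn tau).+1.
exists S; split=> // t /= t0 i; pose n := Num.truncn (t / tau).
have /truncn_itv/andP[] : 0 <= t / tau by rewrite divr_ge0 // ltW.
rewrite -/n ler_pdivlMr // ltr_pdivrMr // -natr1 mulrDl mul1r => nt tn.
have s0 : 0 <= t - n%:R * tau by rewrite subr_ge0.
rewrite -[t](subrK (n%:R * tau)) iterP //; apply: rS; rewrite /= s0 /=.
by rewrite (le_trans _ (ltW (truncnS_gt tau))) // lerBlDl ltW.
Qed.

Lemma periodic_boundedT : periodic_during [set: R] r v C ->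
  bounded_during [set: R] r.
Proof.
move=> [tau tau0 per].
have [|S [finS sS rS]] := periodic_bounded.
  by exists tau => // t _; exact: per.
exists S; split=> // t _ i.
have iterP n : r (t + n%:R * tau) i = r t i.
  elim: n => [|n IH]; first by rewrite mul0r addr0.
  by rewrite -IH -natr1 mulrDl mul1r addrA; have [->] := per (t + n%:R * tau) I.
(* Enough periods are added to exceed the absolute value of [t], which moves it to a nonnegative
   time. *)
rewrite -(iterP (Num.truncn (`|t| / tau)).+1); apply: rS => /=.
have := truncnS_gt (`|t| / tau); rewrite ltr_pdivrMr //.
by have := lerNnormlW (lexx `|t|); lra.
Qed.

End Evolution.

Theorem proposition4p2 (R : realType) (N : nat) (hN : (1 <= N)%N)
    (dt : 'I_N.+1 -> R) (hdt : displacements dt)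
    (r0 v0 : 'I_N -> 'cV[R]_2) (C0 : 'cV[R]_2 -> int)
    (hI : initial_condition dt r0 v0 C0)
    (r v : R -> 'I_N -> 'cV[R]_2) (C : R -> 'cV[R]_2 -> int)
    (hE : evolution dt r0 v0 C0 r v C) :
  [<-> bounded_during [set t : R | 0 <= t] r;
       bounded_during [set: R] r;
       periodic_during [set t : R | 0 <= t] r v C;
       periodic_during [set: R] r v C].
Proof.
(* Recurrence holds at every real time, so one argument serves both the half line and the whole
   line. *)
have bounded_periodic (D : set R) :
    bounded_during [set t : R | 0 <= t] r -> periodic_during D r v C.
  move=> /(bounded_recurrent hdt hI hE)[p p0 same].
  exists p%:~R; first by rewrite ltr0z.
  by move=> t _; have [er ev eC] := same t; split=> // h /eC.
have sub_bounded :
    bounded_during [set: R] r -> bounded_during [set t : R | 0 <= t] r.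
  by move=> [S [finS sS rS]]; exists S; split=> // t _; exact: rS.
tfae.
- by move=> /(bounded_periodic setT); exact: (periodic_boundedT hdt hI hE).
- by move=> /sub_bounded; exact: bounded_periodic.
(* The given period is not extended to negative times; boundedness supplies an integer period valid
   for all time. *)
- by move=> /(periodic_bounded hdt hI hE); exact: bounded_periodic.
- by move=> /(periodic_boundedT hdt hI hE).
Qed.
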